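(* Let $k$ be a field and let $A$ be a connected graded-commutative quadratic $k$-algebra. For a finite-dimensional subspace $W\subseteq A_1$ let $B_W:=\langle W\rangle_A$ be the graded subalgebra of $A$ generated by $W$. Assume that for every finite-dimensional subspace $W\subseteq A_1$ the subalgebra $B_W$ is a universally Koszul quadratic algebra. Then $A$ is the directed union of finite-type universally Koszul quadratic subalgebras.
   Context: A graded $k$-algebra $A=\bigoplus_{n\ge 0}A_n$ is connected if $A_0=k$; graded-commutative means $ab=(-1)^{mn}ba$ for $a\in A_m$, $b\in A_n$. A connected graded $k$-algebra generated in degree $1$ is quadratic if $A\cong T(V)/\langle R\rangle$ as graded algebras, where $V=A_1$ (possibly infinite-dimensional) and $R\subseteq V\otimes_k V$ is a subspace. A quadratic algebra $A$ is of finite type if $\dim_k A_1<\infty$. Universal Koszulity: let $A$ be a quadratic algebra with $\dim_k A_1<\infty$. Let $\mathcal L(A)$ be the set of graded left ideals $I\subseteq A$ with $I=A I_1$ (generated in degree $1$). $A$ is universally Koszul if for every $I\in\mathcal L(A)$ and every $x\in A_1\setminus I_1$, the colon ideal $I:x=\{a\in A\mid ax\in I\}$ belongs to $\mathcal L(A)$. *)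

(* Defs.v *)
From HB Require Import structures.
From mathcomp Require Import all_boot all_order all_algebra.
From mathcomp Require Import finmap monalg.
From mathcomp Require Import boolp classical_sets.

Set Implicit Arguments.
Unset Strict Implicit.
Unset Printing Implicit Defensive.

Import GRing.Theory.

Local Open Scope classical_set_scope.
Local Open Scope ring_scope.
Local Open Scope quotient_scope.

(* No dimension bound is assumed anywhere, so subspaces are classical sets
   (vector.v only covers finite-dimensional spaces); each one is also turned
   into an lmodType, its elements being a sigma type. *)

Section Subspaces.
Variables (k : fieldType) (V : lmodType k).

Record lsubspace := LSubspace {
  lsubspace_set :> set V;
  lsubspace_closed : submod_closed [in lsubspace_set] }.

Definition lsubspace_pred (U : lsubspace) : {pred V} := [in lsubspace_set U].

HB.instance Definition _ (U : lsubspace) :=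
  GRing.isSubmodClosed.Build k V (lsubspace_pred U) (lsubspace_closed U).

Definition lsubspace_type (U : lsubspace) : Type :=
  {x : V | x \in lsubspace_pred U}.

HB.instance Definition _ (U : lsubspace) :=
  SubChoice.on (lsubspace_type U).
HB.instance Definition _ (U : lsubspace) :=
  [SubChoice_isSubLmodule of lsubspace_type U by <:].

Lemma span_closed (S : set V) :
  submod_closed [in smallest (fun M : set V => submod_closed [in M]) S].
Proof.
split; first by rewrite inE => M [[M0 _] _]; rewrite inE in M0.
move=> a u v; rewrite !inE => Su Sv M SM.
have := SM.1.2 a u v; rewrite !inE; apply; [exact: Su|exact: Sv].
Qed.

Definition span (S : set V) : lsubspace := LSubspace (span_closed S).

Definition finite_dimensional (U : lsubspace) : Prop :=
  exists s : seq V, U = span [set` s] :> set V.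

End Subspaces.

Section Subalgebras.
Variables (k : fieldType) (A : algType k).

Record subalgebra := Subalgebra {
  subalgebra_set :> set A;
  subalgebra_closed : subalg_closed [in subalgebra_set] }.

Definition subalgebra_pred (B : subalgebra) : {pred A} :=
  [in subalgebra_set B].

HB.instance Definition _ (B : subalgebra) :=
  GRing.isSubalgClosed.Build k A (subalgebra_pred B) (subalgebra_closed B).

Definition subalgebra_type (B : subalgebra) : Type :=
  {x : A | x \in subalgebra_pred B}.

HB.instance Definition _ (B : subalgebra) :=
  SubChoice.on (subalgebra_type B).
HB.instance Definition _ (B : subalgebra) :=
  [SubChoice_isSubAlgebra of subalgebra_type B by <:].

Lemma gen_subalgebra_closed (S : set A) :
  subalg_closed [in smallest (fun M : set A => subalg_closed [in M]) S].
Proof.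
split.
- by rewrite inE => M [[M1 _ _] _]; rewrite inE in M1.
- move=> a u v; rewrite !inE => Su Sv M SM; have [_ Ml _] := SM.1.
  by have := Ml a u v; rewrite !inE; apply; [exact: Su|exact: Sv].
- move=> u v; rewrite !inE => Su Sv M SM; have [_ _ Mm] := SM.1.
  by have := Mm u v; rewrite !inE; apply; [exact: Su|exact: Sv].
Qed.

Definition gen_subalgebra (S : set A) : subalgebra :=
  Subalgebra (gen_subalgebra_closed S).

End Subalgebras.

(* MathComp's algTypes are nontrivial rings, so only proper ideals have a
   quotient algebra; ring_quotient.v supplies the quotient as a zmodType, and
   its ring structure only in the commutative case. *)

Section QuotientAlgebra.
Variables (k : fieldType) (A : algType k).

Definition ideal_closed (I : set A) : Prop :=
  submod_closed [in I] /\ forall a x, I x -> I (a * x) /\ I (x * a).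

Record proper_tideal := ProperTIdeal {
  tideal_set :> set A;
  tideal_closed : ideal_closed tideal_set;
  tideal_proper : ~ tideal_set 1 }.

Definition tideal_pred (I : proper_tideal) : A -> bool :=
  fun x => x \in tideal_set I.

Lemma tideal_zmod_closed (I : proper_tideal) : zmod_closed (tideal_pred I).
Proof.
case: (tideal_closed I) => -[I0 Il] _; split=> // x y xI yI.
by rewrite addrC -scaleN1r; exact: Il.
Qed.

HB.instance Definition _ (I : proper_tideal) :=
  GRing.isZmodClosed.Build A (tideal_pred I) (tideal_zmod_closed I).

Definition tideal_zmod (I : proper_tideal) : zmodClosed A :=
  GRing.ZmodClosed.clone A (tideal_pred I) _.

Definition quot_algebra (I : proper_tideal) : Type := Quotient.quot (tideal_zmod I).

HB.instance Definition _ (I : proper_tideal) :=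
  GRing.Zmodule.copy (quot_algebra I) (Quotient.quot (tideal_zmod I)).

Variable I : proper_tideal.
Local Notation Q := (quot_algebra I).

Definition quot_pi (x : A) : Q := \pi_(Quotient.quot (tideal_zmod I)) x.

Lemma quot_piP (x y : A) : quot_pi x = quot_pi y <-> tideal_set I (x - y).
Proof.
split=> [/eqmodP|xy]; first by rewrite /= /Quotient.equiv inE.
by apply/eqmodP; rewrite /= /Quotient.equiv inE.
Qed.

Lemma quot_pi_repr (q : Q) : quot_pi (repr q) = q.
Proof. exact: reprK. Qed.

Lemma quot_piD : {morph quot_pi : x y / x + y}.
Proof. exact: (@Quotient.pi_add _ (tideal_zmod I)). Qed.

Definition quot_one : Q := quot_pi 1.
Definition quot_mul (p q : Q) : Q := quot_pi (repr p * repr q).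
Definition quot_scale (a : k) (q : Q) : Q := quot_pi (a *: repr q).

Lemma tideal_mull a x : tideal_set I x -> tideal_set I (a * x).
Proof. by case: (tideal_closed I) => _ /(_ a x) H /H[]. Qed.

Lemma tideal_mulr a x : tideal_set I x -> tideal_set I (x * a).
Proof. by case: (tideal_closed I) => _ /(_ a x) H /H[]. Qed.

Lemma tidealD x y : tideal_set I x -> tideal_set I y -> tideal_set I (x + y).
Proof.
case: (tideal_closed I) => -[_ Il] _ Ix Iy.
by have := Il 1 x y; rewrite !inE scale1r; apply.
Qed.

Lemma tidealZ a x : tideal_set I x -> tideal_set I (a *: x).
Proof. by move=> Ix; rewrite -mulr_algl; exact: tideal_mull. Qed.

Lemma repr_quot_pi x : tideal_set I (repr (quot_pi x) - x).
Proof. by apply/quot_piP; rewrite quot_pi_repr. Qed.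

Lemma quot_piM_def x y : quot_mul (quot_pi x) (quot_pi y) = quot_pi (x * y).
Proof.
apply/quot_piP; set x' := repr _; set y' := repr _.
have -> : x' * y' - x * y = (x' - x) * y' + x * (y' - y).
  by rewrite mulrBl mulrBr addrA subrK.
apply: tidealD; [apply: tideal_mulr|apply: tideal_mull]; exact: repr_quot_pi.
Qed.

Lemma quot_piZ_def a x : quot_scale a (quot_pi x) = quot_pi (a *: x).
Proof.
by apply/quot_piP; rewrite -scalerBr; apply: tidealZ; exact: repr_quot_pi.
Qed.

Lemma quot_ind (P : Q -> Prop) : (forall x, P (quot_pi x)) -> forall q, P q.
Proof. by move=> H q; rewrite -(quot_pi_repr q). Qed.

Lemma quot_mulA : associative quot_mul.
Proof.
elim/quot_ind=> x; elim/quot_ind=> y; elim/quot_ind=> z.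
by rewrite !quot_piM_def mulrA.
Qed.

Lemma quot_mul1q : left_id quot_one quot_mul.
Proof. by elim/quot_ind=> x; rewrite quot_piM_def mul1r. Qed.

Lemma quot_mulq1 : right_id quot_one quot_mul.
Proof. by elim/quot_ind=> x; rewrite quot_piM_def mulr1. Qed.

Lemma quot_mulDl : left_distributive quot_mul +%R.
Proof.
elim/quot_ind=> x; elim/quot_ind=> y; elim/quot_ind=> z.
by rewrite -quot_piD !quot_piM_def mulrDl quot_piD.
Qed.

Lemma quot_mulDr : right_distributive quot_mul +%R.
Proof.
elim/quot_ind=> x; elim/quot_ind=> y; elim/quot_ind=> z.
by rewrite -quot_piD !quot_piM_def mulrDr quot_piD.
Qed.

Lemma quot_pi0 : quot_pi 0 = 0.
Proof. by apply: (addIr (quot_pi 0)); rewrite -quot_piD !add0r. Qed.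

Lemma quot_one_neq0 : quot_one != 0.
Proof.
apply/eqP; rewrite -quot_pi0 => /quot_piP; rewrite subr0.
exact: tideal_proper.
Qed.

HB.instance Definition _ := GRing.Zmodule_isNzRing.Build Q
  quot_mulA quot_mul1q quot_mulq1 quot_mulDl quot_mulDr quot_one_neq0.

Lemma quot_scaleA a b (q : Q) :
  quot_scale a (quot_scale b q) = quot_scale (a * b) q.
Proof. by elim/quot_ind: q => x; rewrite !quot_piZ_def scalerA. Qed.

Lemma quot_scale1 : left_id 1 quot_scale.
Proof. by elim/quot_ind=> x; rewrite quot_piZ_def scale1r. Qed.

Lemma quot_scaleDr : right_distributive quot_scale +%R.
Proof.
move=> a; elim/quot_ind=> x; elim/quot_ind=> y.
by rewrite -quot_piD !quot_piZ_def scalerDr quot_piD.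
Qed.

Lemma quot_scaleDl (q : Q) : {morph quot_scale^~ q : a b / a + b}.
Proof.
by move=> a b; elim/quot_ind: q => x; rewrite !quot_piZ_def scalerDl quot_piD.
Qed.

HB.instance Definition _ := GRing.Zmodule_isLmodule.Build k Q
  quot_scaleA quot_scale1 quot_scaleDr quot_scaleDl.

Lemma quot_scaleAl a (p q : Q) : a *: (p * q) = (a *: p) * q.
Proof.
elim/quot_ind: p => x; elim/quot_ind: q => y; rewrite /GRing.scale /GRing.mul /=.
by rewrite !(quot_piM_def, quot_piZ_def) scalerAl.
Qed.

HB.instance Definition _ := GRing.Lmodule_isLalgebra.Build k Q quot_scaleAl.

Lemma quot_scaleAr a (p q : Q) : a *: (p * q) = p * (a *: q).
Proof.
elim/quot_ind: p => x; elim/quot_ind: q => y; rewrite /GRing.scale /GRing.mul /=.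
by rewrite !(quot_piM_def, quot_piZ_def) scalerAr.
Qed.

HB.instance Definition _ := GRing.Lalgebra_isAlgebra.Build k Q quot_scaleAr.

Lemma quot_pi_linear : linear quot_pi.
Proof. by move=> a x y; rewrite quot_piD -quot_piZ_def. Qed.

Lemma quot_pi_monoid : monoid_morphism quot_pi.
Proof. by split=> // x y; rewrite -quot_piM_def. Qed.

HB.instance Definition _ :=
  GRing.isLinear.Build k A Q *:%R quot_pi quot_pi_linear.
HB.instance Definition _ :=
  GRing.isMonoidMorphism.Build A Q quot_pi quot_pi_monoid.

End QuotientAlgebra.

Section GeneratedIdeal.
Variables (k : fieldType) (A : algType k).

Definition gen_ideal (S : set A) : set A := smallest (@ideal_closed k A) S.

Lemma gen_ideal_closed (S : set A) : ideal_closed (gen_ideal S).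
Proof.
split; first split.
- by rewrite inE => M [[[M0 _] _] _]; rewrite inE in M0.
- move=> a u v; rewrite !inE => Su Sv M SM; have [[_ Ml] _] := SM.1.
  by have := Ml a u v; rewrite !inE; apply; [exact: Su|exact: Sv].
- move=> a x Sx; split=> M SM; have [_ Mm] := SM.1.
  + by have [] := Mm a x (Sx M SM).
  + by have [] := Mm a x (Sx M SM).
Qed.

End GeneratedIdeal.

Section FreeAlgebra.
Variables (k : fieldType) (X : choiceType).

Definition free_algebra : Type := {malg k[{fmonom X}]}.

HB.instance Definition _ := GRing.Lalgebra.on free_algebra.

Lemma free_scaleAr a (p q : free_algebra) : a *: (p * q) = p * (a *: q).
Proof.
apply/malgP => m; rewrite mcoeffZ.
have sq : (msupp (a *: q) `<=` msupp q)%fset by exact: msuppZ_le.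
rewrite (mcoeffMlw _ (fsubset_refl (msupp p)) sq) mcoeffMl mulr_sumr.
apply: eq_bigr => i _; rewrite mulr_sumr; apply: eq_bigr => j _.
by rewrite mcoeffZ mulrnAr mulrCA.
Qed.

HB.instance Definition _ :=
  GRing.Lalgebra_isAlgebra.Build k free_algebra free_scaleAr.

Definition free_var (x : X) : free_algebra := mkmalgU (fmu x) 1.

Definition const_coef (p : free_algebra) : k := @mcoeff {fmonom X} k mone p.

Lemma const_coef_var x : const_coef (free_var x) = 0.
Proof. by rewrite /const_coef mcoeffU1 fmP fmU fm1. Qed.

Lemma const_coef_ideal_closed :
  ideal_closed ([set p | const_coef p = 0] : set free_algebra).
Proof.
split; first split; rewrite ?inE /= /const_coef ?mcoeff0 //.
- move=> a u v; rewrite !inE /= => u0 v0.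
  by rewrite mcoeffD mcoeffZ u0 v0 mulr0 addr0.
- by move=> a x /= x0; rewrite !rmorphM /= x0 mulr0 mul0r.
Qed.

End FreeAlgebra.

(* T(V) is the free associative algebra on the underlying set of V modulo the
   relations making V -> T(V) linear. *)

Section TensorAlgebra.
Variables (k : fieldType) (V : lmodType k).

Definition tensor_relations : set (free_algebra k V) :=
  [set p | exists a u v,
     p = free_var k (a *: u + v) - (a *: free_var k u + free_var k v)].

Lemma tensor_relations_proper : ~ gen_ideal tensor_relations 1.
Proof.
move=> /(_ _ (conj (const_coef_ideal_closed k V) _)) h.
have /= : const_coef (1 : free_algebra k V) = 0.
  apply: h => _ [a [u [v ->]]] /=; rewrite /const_coef.
  rewrite mcoeffB mcoeffD mcoeffZ -!/(const_coef _) !const_coef_var.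
  by rewrite mulr0 addr0 subr0.
by rewrite /const_coef mcoeff1 eqxx => /eqP; rewrite oner_eq0.
Qed.

Definition tensor_ideal : proper_tideal (free_algebra k V) :=
  ProperTIdeal (gen_ideal_closed _) tensor_relations_proper.

Definition tensor_algebra : algType k := quot_algebra tensor_ideal.

Definition tensor_incl (v : V) : tensor_algebra :=
  quot_pi tensor_ideal (free_var k v).

(* The degree n component; tensor_power 2 is the copy of V (x) V in T(V). *)
Definition tensor_power (n : nat) : lsubspace tensor_algebra :=
  span (range (fun v : 'I_n -> V => \prod_(i < n) tensor_incl (v i))).

Lemma gen_ideal_quadratic_proper (R : set tensor_algebra) :
  R `<=` tensor_power 2 -> ~ gen_ideal R 1.
Proof.
pose M : set tensor_algebra :=
  [set x | exists2 p, x = quot_pi tensor_ideal p & const_coef p = 0].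
have [[F0 Fl] Fm] := const_coef_ideal_closed k V.
have MI : ideal_closed M.
  split; first split.
  - by rewrite inE /M /=; exists 0; rewrite ?raddf0 // /const_coef mcoeff0.
  - move=> a u v; rewrite !inE => -[p -> p0] [q -> q0].
    exists (a *: p + q); first by rewrite linearP.
    by have := Fl a p q; rewrite !inE; apply.
  - move=> a x [p -> p0]; rewrite -[a]quot_pi_repr; split.
    + exists (repr a * p); first by rewrite rmorphM.
      exact: (Fm _ _ p0).1.
    + exists (p * repr a); first by rewrite rmorphM.
      exact: (Fm _ _ p0).2.
have M2 : tensor_power 2 `<=` M.
  apply: smallest_sub; first exact: MI.1.
  move=> _ [v _ <-]; exists (\prod_(i < 2) free_var k (v i)).
    by rewrite rmorph_prod.
  by rewrite big_ord_recl; apply: (Fm _ _ _).2; exact: const_coef_var.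
move=> R2 /(_ M (conj MI (subset_trans R2 M2))) [p /quot_piP].
move=> /(_ _ (conj (const_coef_ideal_closed k V) _)) h p0.
have /= : const_coef (1 - p) = 0.
  apply: h => _ [a [u [v ->]]] /=; rewrite /const_coef.
  rewrite mcoeffB mcoeffD mcoeffZ -!/(const_coef _) !const_coef_var.
  by rewrite mulr0 addr0 subr0.
rewrite /const_coef mcoeffB -/(const_coef p) p0 subr0 mcoeff1 eqxx.
by move/eqP; rewrite oner_eq0.
Qed.

Definition quadratic_ideal (R : lsubspace tensor_algebra)
    (R2 : R `<=` tensor_power 2) : proper_tideal tensor_algebra :=
  ProperTIdeal (gen_ideal_closed _) (gen_ideal_quadratic_proper R2).

End TensorAlgebra.

Section GradedAlgebras.
Variables (k : fieldType) (A : algType k).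
Implicit Type G : nat -> lsubspace A.

(* S is the sum of its homogeneous parts S_i := S `&` G i. *)
Definition homogeneous G (S : set A) : Prop :=
  forall x, S x -> exists n (f : nat -> A),
    (forall i, (S `&` G i) (f i)) /\ x = \sum_(i < n) f i.

Record graded_algebra G : Prop := GradedAlgebra {
  graded_one : (G 0%N : set A) 1;
  graded_mul : forall m n a b,
    (G m : set A) a -> (G n : set A) b -> (G (m + n)%N : set A) (a * b);
  graded_sum : homogeneous G setT;
  graded_direct : forall n (f : nat -> A), (forall i, (G i : set A) (f i)) ->
    \sum_(i < n) f i = 0 -> forall i, (i < n)%N -> f i = 0 }.

Definition connected_graded G : Prop :=
  (G 0%N : set A) = range (fun c : k => c%:A).

Definition graded_commutative G : Prop :=
  forall m n a b, (G m : set A) a -> (G n : set A) b ->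
    a * b = (-1) ^+ (m * n) * (b * a).

Definition generated_in_degree1 G : Prop :=
  (gen_subalgebra (G 1%N) : set A) = setT.

Definition quadratic G : Prop :=
  [/\ graded_algebra G, connected_graded G, generated_in_degree1 G &
  let V : lmodType k := lsubspace_type (G 1%N) in
  exists (R : lsubspace (tensor_algebra V)) (R2 : R `<=` tensor_power V 2)
         (f : {lrmorphism quot_algebra (quadratic_ideal R2) -> A}),
    bijective f /\
    forall n, f @` (quot_pi (quadratic_ideal R2) @` tensor_power V n) = G n].

Definition finite_type G : Prop := finite_dimensional (G 1%N).

Definition left_ideal (I : set A) : Prop :=
  submod_closed [in I] /\ forall a x, I x -> I (a * x).

Definition degree1_left_ideals G : set (set A) :=
  [set I | [/\ left_ideal I, homogeneous G I &
    I = span [set a * v | a in setT & v in I `&` G 1%N]]].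

Definition colon (I : set A) (x : A) : set A := [set a | I (a * x)].

(* For quadratic G of finite type; these two conditions are not repeated
   inside the definition. Given x in G 1, x not in I is the same as x not in
   I_1 = I `&` G 1. *)
Definition universally_Koszul G : Prop :=
  forall I x, degree1_left_ideals G I -> (G 1%N : set A) x -> ~ I x ->
    degree1_left_ideals G (colon I x).

End GradedAlgebras.

Section InducedGrading.
Variables (k : fieldType) (A : algType k) (G : nat -> lsubspace A).
Variable B : subalgebra A.

Lemma induced_closed n :
  submod_closed
    [in [set x : subalgebra_type B | (G n : set A) (\val x)]].
Proof.
have [G0 Gl] := lsubspace_closed (G n); split.
  by rewrite inE in G0; rewrite inE /=; exact: G0.
move=> a u v; rewrite !inE /= => Gu Gv.
by have := Gl a (\val u) (\val v); rewrite !inE; apply.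
Qed.

Definition induced_grading (n : nat) : lsubspace (subalgebra_type B) :=
  LSubspace (induced_closed n).

End InducedGrading.

Section DirectedUnion.
Variables (k : fieldType) (A : algType k).

Definition directed_union (F : set (subalgebra A)) : Prop :=
  [/\ F !=set0,
      forall B C, F B -> F C -> exists D, [/\ F D, B `<=` D & C `<=` D] &
      \bigcup_(B in F) (B : set A) = setT].

End DirectedUnion.

(* Main.v *)
Require Import Defs.
From mathcomp Require Import all_boot all_order all_algebra.
From mathcomp Require Import boolp classical_sets.

(** The subalgebras generated by the finite-dimensional subspaces of [A_1] form
    the required family; they exhaust [A] because [A] is generated in degree 1.
    They are of finite type since [<W>] meets [A_1] in [W] only: the subspace
    [k + W + (A_2 + A_3 + ...)] is a subalgebra containing [W]. *)

Import GRing.Theory.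
Local Notation span := Defs.span.
Local Open Scope classical_set_scope.
Local Open Scope ring_scope.

(** * Linear spans and generated subalgebras *)

Section SubspaceFacts.
Variables (k : fieldType) (V : lmodType k).
Implicit Types (U : lsubspace V) (S T : set V).

Lemma lsubspace0 U : (U : set V) 0.
Proof. by have := (lsubspace_closed U).1; rewrite inE. Qed.

Lemma lsubspaceP U a u v :
  (U : set V) u -> (U : set V) v -> (U : set V) (a *: u + v).
Proof.
by move=> Uu Uv; have := (lsubspace_closed U).2 a u v; rewrite !inE; apply.
Qed.

Lemma lsubspaceD U u v :
  (U : set V) u -> (U : set V) v -> (U : set V) (u + v).
Proof. by move=> Uu Uv; rewrite -[u]scale1r; exact: lsubspaceP. Qed.

Lemma lsubspaceZ U a u : (U : set V) u -> (U : set V) (a *: u).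
Proof.
by move=> Uu; rewrite -[_ *: _]addr0; apply: lsubspaceP => //; exact: lsubspace0.
Qed.

Lemma lsubspaceN U u : (U : set V) u -> (U : set V) (- u).
Proof. by move=> Uu; rewrite -scaleN1r; exact: lsubspaceZ. Qed.

Lemma submod_closedP S : S 0 ->
  (forall a u v, S u -> S v -> S (a *: u + v)) -> submod_closed [in S].
Proof. by move=> S0 Sl; split=> [|a u v]; rewrite !inE //; exact: Sl. Qed.

Lemma sub_span S : S `<=` span S.
Proof. exact: sub_smallest. Qed.

Lemma span_sub S T : submod_closed [in T] -> S `<=` T -> span S `<=` T.
Proof. exact: smallest_sub. Qed.

Lemma span_sub_lsubspace S U : S `<=` U -> span S `<=` U.
Proof. by apply: span_sub; exact: lsubspace_closed. Qed.

Lemma span_mono S T : S `<=` T -> span S `<=` span T.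
Proof. by move=> ST; apply: span_sub_lsubspace => x /ST; exact: sub_span. Qed.

End SubspaceFacts.

Section GeneratedSubalgebra.
Variables (k : fieldType) (A : algType k).
Implicit Types S T : set A.

Lemma subalg_closedP S : S 1 ->
  (forall a u v, S u -> S v -> S (a *: u + v)) ->
  (forall u v, S u -> S v -> S (u * v)) -> subalg_closed [in S].
Proof.
move=> S1 Sl Sm; split=> [|a u v|u v]; rewrite !inE //; [exact: Sl|exact: Sm].
Qed.

Lemma sub_gen_subalgebra S : S `<=` gen_subalgebra S.
Proof. exact: sub_smallest. Qed.

Lemma gen_subalgebra_sub S T :
  subalg_closed [in T] -> S `<=` T -> gen_subalgebra S `<=` T.
Proof. exact: smallest_sub. Qed.

Lemma gen_subalgebra_mono S T :
  S `<=` T -> gen_subalgebra S `<=` gen_subalgebra T.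
Proof.
move=> ST; apply: gen_subalgebra_sub; first exact: subalgebra_closed.
by move=> x /ST; exact: sub_gen_subalgebra.
Qed.

End GeneratedSubalgebra.

(** * The degree-one part of a generated subalgebra *)

Section DegreeOnePart.
Variables (k : fieldType) (A : algType k) (G : nat -> lsubspace A).
Hypotheses (gradedA : graded_algebra G) (connA : connected_graded G).

(** The tail [A_2 + A_3 + ...]. Taken as a span, it lets closure properties be checked on
    homogeneous elements through [span_sub]. *)
Definition degree_ge2 : lsubspace A :=
  span [set x | exists n, (G n.+2 : set A) x].

(** For fixed [a], the [x] with [a * x] in the tail form a subspace, so a homogeneous [x] of degree
    [n.+2] suffices; the product then has degree [(m + n).+2]. *)
Lemma degree_ge2_mull m a x :
  (G m : set A) a -> (degree_ge2 : set A) x -> (degree_ge2 : set A) (a * x).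
Proof.
move=> Ga; move: x; apply: span_sub => [|x [n Gx]].
  apply: submod_closedP => [|c u v Hu Hv].
    by rewrite mulr0; exact: lsubspace0.
  by rewrite mulrDr -scalerAr; exact: lsubspaceP.
apply: sub_span; exists (m + n)%N; rewrite -!addnS.
exact: (graded_mul gradedA).
Qed.

Lemma degree_ge2_mulr m a x :
  (G m : set A) a -> (degree_ge2 : set A) x -> (degree_ge2 : set A) (x * a).
Proof.
move=> Ga; move: x; apply: span_sub => [|x [n Gx]].
  apply: submod_closedP => [|c u v Hu Hv].
    by rewrite mul0r; exact: lsubspace0.
  by rewrite mulrDl -scalerAl; exact: lsubspaceP.
apply: sub_span; exists (n + m)%N; rewrite -!addSn.
exact: (graded_mul gradedA).
Qed.

Lemma degree_ge2_mul x y :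
  (degree_ge2 : set A) x -> (degree_ge2 : set A) y ->
  (degree_ge2 : set A) (x * y).
Proof.
move=> + Hy; move: x; apply: span_sub => [|x [n Gx]].
  apply: submod_closedP => [|c u v Hu Hv].
    by rewrite mul0r; exact: lsubspace0.
  by rewrite mulrDl -scalerAl; exact: lsubspaceP.
exact: degree_ge2_mull Gx Hy.
Qed.

Lemma degree_ge2_decomp x : (degree_ge2 : set A) x ->
  exists n (f : nat -> A),
    (forall i, (G i.+2 : set A) (f i)) /\ x = \sum_(i < n) f i.
Proof.
(* Padding by zeros brings two sums to a common length, so that they can be combined termwise. *)
have pad n m (f : nat -> A) : (n <= m)%N -> \sum_(i < n) f i =
    \sum_(i < m) (if (i < n)%N then f i else 0).
  by move=> le_nm; rewrite -big_mkcond (big_ord_widen m f le_nm).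
move: x; apply: span_sub => [|x [n Gx]].
  apply: submod_closedP.
    exists 0%N, (fun=> 0); split=> [i|]; first exact: lsubspace0.
    by rewrite big_ord0.
  move=> c _ _ [n [f [Gf ->]]] [m [g [Gg ->]]].
  exists (maxn n m), (fun i => c *: (if (i < n)%N then f i else 0)
                             + (if (i < m)%N then g i else 0)); split.
    move=> i; apply: lsubspaceP; case: ifP => _ //; exact: lsubspace0.
  by rewrite big_split -scaler_sumr -!pad ?leq_maxl ?leq_maxr.
(* Slot [i] carries degree [i.+2], so an element of degree [n.+2] sits in slot [n], the last of
   [n.+1]. *)
exists n.+1, (fun i => if i == n then x else 0); split.
  by move=> i; case: eqP => [->|_] //; exact: lsubspace0.
rewrite big_ord_recr /= eqxx big1 ?add0r // => i _.
by rewrite ltn_eqF.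
Qed.

(** Once [x] is split into components of degree at least 2, the equation is a vanishing sum of
    homogeneous terms, and directness of the grading kills each of them. *)
Lemma low_degree_ge2 a b x : (G 0%N : set A) a -> (G 1%N : set A) b ->
  (degree_ge2 : set A) x -> a + b + x = 0 -> b = 0.
Proof.
move=> Ga Gb /degree_ge2_decomp[n [f [Gf ->]]] ab0.
(* The sequence [a, b, f 0, f 1, ...] lists the components by degree; hence the length [n.+2]
   below. *)
pose g i := if i is i'.+1 then if i' is i''.+1 then f i'' else b else a.
have Gg i : (G i : set A) (g i) by case: i => [|[|i]].
apply: (graded_direct gradedA Gg (n := n.+2) _ (i := 1%N)) => //.
by rewrite !big_ord_recl /= addrA; exact: ab0.
Qed.

Variable W : lsubspace A.
Hypothesis WG : W `<=` G 1%N.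

(** The elements of this form make up a subalgebra containing [W]: a product of two elements of [W]
    already lies in degree 2. *)
Lemma gen_subalgebra_decomp x : (gen_subalgebra W : set A) x ->
  exists c w y, [/\ (W : set A) w, (degree_ge2 : set A) y & x = c%:A + w + y].
Proof.
move: x; apply: gen_subalgebra_sub.
  apply: subalg_closedP.
  - exists 1, 0, 0; rewrite scale1r !addr0.
    by split=> //; exact: lsubspace0.
  - move=> a _ _ [c [w [y [Ww Hy ->]]]] [d [v [z [Wv Hz ->]]]].
    exists (a * c + d), (a *: w + v), (a *: y + z).
    split; [exact: lsubspaceP|exact: lsubspaceP|].
    rewrite !scalerDr scalerA scalerDl [in LHS]addrACA.
    by congr (_ + _); rewrite addrACA.
  - move=> _ _ [c [w [y [Ww Hy ->]]]] [d [v [z [Wv Hz ->]]]].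
    (* Expansion of [(c + w + y) * (d + v + z)]: only the scalar multiples of [v] and [w] have
       degree 1, and the other nonscalar terms fall into the tail. *)
    exists (c * d), (c *: v + d *: w), (c *: z + (w * v + w * z)
                                        + (d *: y + y * v + y * z)); split.
    + by apply: lsubspaceD; exact: lsubspaceZ.
    + have Hwv : (degree_ge2 : set A) (w * v).
        apply: sub_span; exists 0%N.
        exact: (graded_mul gradedA (WG _ Ww) (WG _ Wv)).
      by do ![apply: lsubspaceD | exact: lsubspaceZ | exact: Hwv
        | exact: degree_ge2_mul | exact: (degree_ge2_mull _ _ _ (WG _ Ww))
        | exact: (degree_ge2_mulr _ _ _ (WG _ Wv))].
    + rewrite !mulrDl !mulrDr -!scalerAl !mul1r -!scalerAr !mulr1 !scalerA.
      by rewrite !addrA (addrAC (_ + _) (c *: z)).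
move=> w Ww; exists 0, w, 0; rewrite scale0r add0r addr0.
by split=> //; exact: lsubspace0.
Qed.

Lemma gen_subalgebra_degree1 x :
  (gen_subalgebra W : set A) x -> (G 1%N : set A) x -> (W : set A) x.
Proof.
move=> /gen_subalgebra_decomp[c [w [y [Ww Hy xE]]]] Gx.
suff : w - x = 0 by move/subr0_eq <-.
(* From [x = c%:A + w + y], the element [w - x] is the degree-one term of a vanishing sum;
   connectedness places [c%:A] in degree 0. *)
apply: (low_degree_ge2 c%:A (w - x) y) => //.
- by rewrite connA; exists c.
- by apply: lsubspaceD; [exact: WG|exact: lsubspaceN].
- by rewrite addrA (addrAC _ (- x)) -xE subrr.
Qed.

(** The degree-one part of the subalgebra is [W], so a spanning list of [W] works once lifted from
    [A] to the subtype of [B]. *)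
Lemma finite_type_gen_subalgebra : finite_dimensional W ->
  finite_type (induced_grading G (gen_subalgebra W)).
Proof.
move=> [s sW]; set B := gen_subalgebra W.
have sub_sW x : x \in s -> (W : set A) x by rewrite sW => xs; exact: sub_span.
have sub_sB x : x \in s -> x \in subalgebra_pred B.
  by move=> /sub_sW ?; rewrite inE; exact: sub_gen_subalgebra.
(* By [sub_sB] every entry of [s] lies in [B], so [insub] discards none. *)
pose t : seq (subalgebra_type B) := pmap insub s.
exists t; apply/seteqP; split.
  move=> x Gx.
  have : (W : set A) (\val x).
    apply: gen_subalgebra_degree1 Gx.
    by have := valP x; rewrite inE.
  (* The image under [\val] of the span of [t] is a subspace of [A] containing [s], hence [W];
     injectivity of [\val] brings the result back to [B]. *)
  rewrite sW => /(span_sub _ _ _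
    [set y | exists2 z, (span [set` t] : set _) z & \val z = y]) [].
  - apply: submod_closedP.
      by exists 0; rewrite ?raddf0 //; exact: lsubspace0.
    move=> a _ _ [u tu <-] [v tv <-].
    by exists (a *: u + v); rewrite ?linearP //; exact: lsubspaceP.
  - move=> y /= ys; exists (exist _ y (sub_sB y ys)) => //.
    by apply: sub_span; rewrite /= mem_pmap_sub.
  - by move=> z tz /val_inj <-.
apply: span_sub_lsubspace => x /=; rewrite mem_pmap_sub => xs.
by apply: WG; exact: sub_sW.
Qed.

End DegreeOnePart.

(** * The directed family of finitely generated subalgebras *)

Definition fd_generated {k : fieldType} {A : algType k}
    (G : nat -> lsubspace A) : set (subalgebra A) :=
  [set B | exists W : lsubspace A,
     [/\ W `<=` G 1%N, finite_dimensional W & B = gen_subalgebra W]].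

Lemma fd_generated_directed (k : fieldType) (A : algType k)
    (G : nat -> lsubspace A) : generated_in_degree1 G ->
  directed_union (fd_generated G).
Proof.
have spanG (s : seq A) : [set` s] `<=` G 1%N ->
    fd_generated G (gen_subalgebra (span [set` s])).
  move=> sG; exists (span [set` s]); split=> //; last by exists s.
  exact: span_sub_lsubspace.
have directed B C : fd_generated G B -> fd_generated G C ->
    exists D, [/\ fd_generated G D, B `<=` D & C `<=` D].
  move=> [W [WG [s sW] ->]] [U [UG [t tU] ->]].
  (* The concatenated list spans [W + U], whose subalgebra contains both given ones. *)
  exists (gen_subalgebra (span [set` s ++ t])); split.
  - apply: spanG => x /=; rewrite mem_cat => /orP[xs|xt].
    + by apply: WG; rewrite sW; exact: sub_span.
    + by apply: UG; rewrite tU; exact: sub_span.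
  - by apply: gen_subalgebra_mono; rewrite sW; apply: span_mono => x /=;
      rewrite mem_cat => ->.
  - by apply: gen_subalgebra_mono; rewrite tU; apply: span_mono => x /=;
      rewrite mem_cat orbC => ->.
move=> genA; pose B0 := gen_subalgebra (span [set` [::] : seq A]).
split=> //.
  by exists B0; exact: spanG.
(* It remains to see that the union is a subalgebra containing [A_1]. *)
rewrite -subTset -genA; apply: gen_subalgebra_sub.
  (* Directedness puts both arguments into one member, so an operation preserved by every member is
     preserved by the union; this serves for linear combinations and for products. *)
  have closed2 (op : A -> A -> A) :
      (forall (B : subalgebra A) u v,
        (B : set A) u -> (B : set A) v -> (B : set A) (op u v)) ->
      forall u v, (\bigcup_(B in fd_generated G) (B : set A)) u ->
        (\bigcup_(B in fd_generated G) (B : set A)) v ->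
        (\bigcup_(B in fd_generated G) (B : set A)) (op u v).
    move=> opB u v [B FB Bu] [C FC Cv].
    have [D [FD BD CD]] := directed B C FB FC.
    by exists D => //; apply: opB; [exact: BD|exact: CD].
  apply: subalg_closedP.
  - exists B0; first exact: spanG.
    have [B1 _ _] := subalgebra_closed B0.
    by rewrite inE in B1.
  - move=> a; apply: (closed2 (fun u v => a *: u + v)) => B u v Bu Bv.
    have [_ Bl _] := subalgebra_closed B.
    by have := Bl a u v; rewrite !inE; apply.
  - apply: closed2 => B u v Bu Bv.
    have [_ _ Bm] := subalgebra_closed B.
    by have := Bm u v; rewrite !inE; apply.
(* An element of degree 1 lies in the subalgebra generated by its own span. *)
move=> x Gx; exists (gen_subalgebra (span [set` [:: x]])).
  by apply: spanG => y /=; rewrite inE => /eqP->.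
by apply: sub_gen_subalgebra; apply: sub_span; rewrite /= inE.
Qed.

Theorem proposition4p1 (k : fieldType) (A : algType k)
    (G : nat -> lsubspace A)
    (quadA : quadratic G) (commA : graded_commutative G)
    (koszulW : forall W : lsubspace A, W `<=` G 1%N -> finite_dimensional W ->
       quadratic (induced_grading G (gen_subalgebra W)) /\
       universally_Koszul (induced_grading G (gen_subalgebra W))) :
  exists F : set (subalgebra A), directed_union F /\
    forall B, F B -> [/\ quadratic (induced_grading G B),
      finite_type (induced_grading G B) &
      universally_Koszul (induced_grading G B)].
Proof.
have [gradedA connA genA _] := quadA.
exists (fd_generated G); split; first exact: fd_generated_directed.
move=> B [W [WG Wfd ->]]; have [quadB koszulB] := koszulW W WG Wfd.
by split=> //; exact: finite_type_gen_subalgebra.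
Qed.
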